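(* Let $(L,m)$ be a quasi-local principally generated C-lattice domain. Then $L$ is a TAFL if and only if $\dim(L)\leq 1$ and $L$ is a PTAFL. If these equivalent conditions are satisfied, then $\bigwedge_{n\in\mathbb{N}} m^n=0$ and $m^2$ is comparable.
   Context: A multiplicative lattice is a set $L$ with a commutative associative multiplication and a partial order $\leq$ such that $(L,\leq)$ is a complete lattice with greatest element $1$ and least element $0$, and such that $1x=x$ and $x(\bigvee E)=\bigvee\{xe\mid e\in E\}$ for all $x\in L$ and $E\subseteq L$. An element $a\in L$ is compact if for each $F\subseteq L$ with $a\leq\bigvee F$ there is a finite $E\subseteq F$ with $a\leq\bigvee E$. A subset is multiplicatively closed if it contains $1$ and is closed under products. $L$ is a C-lattice if there is a multiplicatively closed subset $C\subseteq L$ of compact elements such that every element of $L$ is a join of elements of $C$. For $a,b\in L$, $(a:b)=\bigvee\{x\in L\mid xb\leq a\}$. An element $e\in L$ is principal if $a\wedge be=((a:e)\wedge b)e$ and $((a\vee be):e)=(a:e)\vee b$ for all $a,b\in L$. $L$ is principally generated if every element of $L$ is a join of principal elements. An element $a$ is proper if $a<1$; it is comparable if for each $b\in L$, $a\leq b$ or $b\leq a$. A proper element $m$ is maximal if $m<x\leq 1$ implies $x=1$. A proper element $p$ is prime if for all $a,b\in L$, $ab\leq p$ implies $a\leq p$ or $b\leq p$. $L$ is a lattice domain (here: a C-lattice domain is a C-lattice which is a lattice domain) if $0$ is a prime element. $L$ is quasi-local if $1$ is compact and $L$ has a unique maximal element; $(L,m)$ quasi-local means that $m$ is this maximal element. $\dim(L)$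 is the supremum of all $n\in\mathbb{N}$ such that there is a strict chain $p_0<p_1<\dots<p_n$ of prime elements of $L$. A proper element $p$ is a TA-element ($2$-absorbing element) if for all $a,b,c\in L$, $abc\leq p$ implies $ab\leq p$ or $bc\leq p$ or $ac\leq p$. A TAFL (resp. PTAFL) is a C-lattice in which every element (resp. every principal element) is a finite product of TA-elements (the element $1$ being the empty product). *)

(* Defs.v *)
From HB Require Import structures.
From mathcomp Require Import all_boot all_order ssralg ssrint.
From mathcomp Require Import boolp classical_sets cardinality constructive_ereal.

Set Implicit Arguments.
Unset Strict Implicit.
Unset Printing Implicit Defensive.

Import Order.TTheory.

Local Open Scope classical_set_scope.
Local Open Scope order_scope.
Local Open Scope group_scope.

(* [supremums A] and [infimums A] are the sets of least upper, resp. greatest  *)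
(* lower, bounds of A, so this says that all subsets have a join and a meet.   *)
HB.mixin Record isCompleteLattice d (L : Type) of Order.TBLattice d L := {
  supremums_neq0 : forall A : set L, supremums A !=set0 ;
  infimums_neq0 : forall A : set L, infimums A !=set0
}.

#[short(type="completeLatticeType")]
HB.structure Definition CompleteLattice d :=
  { L of Order.TBLattice d L & isCompleteLattice d L }.

(* [supremum x0] and [infimum x0] return x0 on the empty set, hence the choice *)
(* of \bot and \top.                                                           *)
Definition Join d (L : completeLatticeType d) (A : set L) : L :=
  supremum \bot A.

Definition Meet d (L : completeLatticeType d) (A : set L) : L :=
  infimum \top A.

(* The multiplication and its powers and finite products are those of          *)
(* monoidType; its unit is required to be the greatest element.                *)
HB.mixin Record isMultLattice d (L : Type)
    of CompleteLattice d L & Monoid L := {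
  mulxC : forall x y : L, x * y = y * x ;
  one_top : (1 : L) = \top ;
  mulx_Join : forall (x : L) (E : set L),
    x * Join E = Join [set x * e | e in E]
}.

#[short(type="multLatticeType")]
HB.structure Definition MultLattice d :=
  { L of CompleteLattice d L & Monoid L & isMultLattice d L }.

Section Elements.
Context {d : Order.disp_t} {L : multLatticeType d}.
Implicit Types (a b c e m p x : L) (C : set L).

Definition compact_elt a : Prop :=
  forall F : set L, a <= Join F ->
    exists E : set L, [/\ finite_set E, E `<=` F & a <= Join E].

Definition mult_closed C : Prop :=
  C 1 /\ forall x y, C x -> C y -> C (x * y).

Definition residual a b : L := Join [set x | x * b <= a].

Definition principal_elt e : Prop :=
  forall a b,
    Order.meet a (b * e) = Order.meet (residual a e) b * e /\
    residual (Order.join a (b * e)) e = Order.join (residual a e) b.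

Definition proper_elt a : Prop := a < \top.

Definition comparable_elt a : Prop := forall b, a >=< b.

Definition maximal_elt m : Prop :=
  proper_elt m /\ forall x, m < x <= \top -> x = \top.

Definition prime_elt p : Prop :=
  proper_elt p /\ forall a b, a * b <= p -> a <= p \/ b <= p.

Definition TA_elt p : Prop :=
  proper_elt p /\
  forall a b c, a * b * c <= p -> [\/ a * b <= p, b * c <= p | a * c <= p].

Definition TA_product x : Prop :=
  exists s : seq L, {in s, forall p, TA_elt p} /\ x = \prod_(p <- s) p.

Definition quasi_local m : Prop :=
  [/\ compact_elt \top, maximal_elt m & forall n : L, maximal_elt n -> n = m].

End Elements.

Section Lattices.
Context {d : Order.disp_t} (L : multLatticeType d).

Definition C_lattice : Prop :=
  exists C : set L,
    [/\ mult_closed C, C `<=` compact_elt &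
        forall x : L, exists2 E : set L, E `<=` C & x = Join E].

Definition principally_generated : Prop :=
  forall x : L, exists2 E : set L, E `<=` principal_elt & x = Join E.

Definition C_lattice_domain : Prop := C_lattice /\ prime_elt (\bot : L).

(* A strict chain p_0 < ... < p_n is a sorted sequence of size n.+1. *)
Definition prime_chain (n : nat) : Prop :=
  exists s : seq L,
    [/\ size s = n.+1, sorted <%O s & {in s, forall p, prime_elt p}].

(* The dimension lives in the extended integers: it is +oo when there are      *)
(* arbitrarily long chains, and -oo when there is no prime element at all.     *)
Definition dimension : \bar int :=
  supremum -oo%E [set (n%:Z)%:E%E | n in [set n : nat | prime_chain n]].

Definition TAFL : Prop := C_lattice /\ forall x : L, TA_product x.

Definition PTAFL : Prop :=
  C_lattice /\ forall x : L, principal_elt x -> TA_product x.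

End Lattices.

(* Main.v *)
Require Import Defs.
From mathcomp Require Import all_boot all_order ssralg ssrint.
From mathcomp Require Import boolp classical_sets cardinality constructive_ereal.

(* Nonzero principal elements are cancellable, and in a quasi-local lattice    *)
(* they are join-irreducible; so the factors of a nonzero principal element    *)
(* are principal.                                                              *)
(* TAFL implies dim <= 1: let p be a prime with p < q for a prime q, pick e    *)
(* principal below q but not below p, and r a minimal prime over p v e. A      *)
(* TA-factorization of p v e^(2n) has at least n factors below r, so           *)
(* p <= r^n for all n. If r = r^2 locally at r, then r lies locally below each *)
(* TA-factor of p v e^3, so e <= p v e^3 locally and cancelling e contradicts  *)
(* p v e^2 <= r. Otherwise some principal TA-element f <= r is not locally     *)
(* below r^2; then r is minimal over f, and r^2 <= f r, whence p <= f^2        *)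
(* locally. If p <> 0, a nonzero principal TA-element t <= p is locally        *)
(* f^2 y, and as f^2 is not below p, f y <= t: cancelling f y contradicts      *)
(* f <= r.                                                                     *)
(* Conversely, if m is the only nonzero prime, each nonzero principal element  *)
(* is a product of principal a <= m with m a = m^2 (so m^2 <= a). If k is the  *)
(* least length of such a product a_1 ... a_k <= x, then x <= m^k =            *)
(* a_2 ... a_k m, so x = y a_2 ... a_k with m^2 <= a_1 <= y <= m, and all      *)
(* elements between m^2 and m are TA-elements.                                 *)
(* L need not be modular, so passing to the quotient L/p is avoided            *)
(* throughout.                                                                 *)

Set Implicit Arguments.
Unset Strict Implicit.
Unset Printing Implicit Defensive.

Import Order.TTheory.

Local Open Scope classical_set_scope.
Local Open Scope order_scope.
Local Open Scope group_scope.

(** In a domain a nonzero principal element cancels ([principal_cancel]). In the quasi-local case a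
    Nakayama argument also makes it join-irreducible ([principal_Join_irr]), so its factors are
    again principal ([principal_factor]).

    The dimension bound is [prime_bot]: a prime strictly below another prime is zero. It combines
    [prime_le_exp], which places the smaller prime below all powers of the larger one, with
    [TA_minimal_prime], which places the square of a minimal prime over [a] locally below each
    TA-element above [a].

    Once every nonzero prime is [m], the nonzero TA-elements lie between [m ^+ 2] and [m], and
    everything in that interval is a TA-element. Nonzero principal elements are products of
    [max_atom]s, and [k] of these multiplied by [m] give [m ^+ k.+1] ([prod_max_atom]). Counting
    such factors yields the zero meet of the powers, the comparability of [m ^+ 2] and the
    factorization of every element ([TA_product_all]). *)

Local Notation "x `|` y" := (Order.join x y) : group_scope.

(** * Joins, meets and Zorn's lemma in complete lattices *)

Section CompleteLattices.
Context {d : Order.disp_t} {L : completeLatticeType d}.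
Implicit Types (x y : L) (A B : set L).

Lemma Join_supremums A : supremums A (Join A).
Proof.
rewrite /Join /supremum; case: ifPn => [/eqP->|_].
  by split=> // x _; exact: le0x.
by have [s sA] := supremums_neq0 A; case: xgetP => [y _ //|/(_ s)].
Qed.

Lemma Meet_infimums A : infimums A (Meet A).
Proof.
rewrite /Meet /infimum; case: ifPn => [/eqP->|_].
  by split=> // x _; exact: lex1.
by have [s sA] := infimums_neq0 A; case: xgetP => [y _ //|/(_ s)].
Qed.

Lemma le_Join A x : A x -> x <= Join A.
Proof. by case: (Join_supremums A) => + _; apply. Qed.

Lemma Join_le A x : (forall y, A y -> y <= x) -> Join A <= x.
Proof. by case: (Join_supremums A) => _; apply. Qed.

Lemma Meet_le A x : A x -> Meet A <= x.
Proof. by case: (Meet_infimums A) => + _; apply. Qed.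

Lemma le_Meet A x : (forall y, A y -> x <= y) -> x <= Meet A.
Proof. by case: (Meet_infimums A) => _; apply. Qed.

Lemma Join_subset A B : A `<=` B -> Join A <= Join B.
Proof. by move=> AB; apply: Join_le => x /AB; exact: le_Join. Qed.

Lemma Join_set2 x y : Join [set x; y] = x `|` y.
Proof.
apply/le_anti/andP; split.
  by apply: Join_le => _ [->|->]; [exact: leUl|exact: leUr].
by rewrite leUx; apply/andP; split; apply: le_Join; [left|right].
Qed.

Definition chain A : Prop := forall x y, A x -> A y -> x <= y \/ y <= x.

Lemma zorn_above (P : set L) a :
  P a -> (forall A, A `<=` P -> A !=set0 -> chain A -> P (Join A)) ->
  exists p, [/\ P p, a <= p & forall b, P b -> p <= b -> b = p].
Proof.
move=> Pa Pchain.
pose T := {x : L | P x /\ a <= x}.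
pose R (x y : T) := sval x <= sval y.
have [| | | A Atot|[p [Pp ap]] pmax] := @Zorn T R.
- by move=> x; exact: lexx.
- by move=> x y z; exact: le_trans.
- by move=> [x ?] [y ?] xy yx; apply/eq_exist/le_anti/andP.
(* The empty chain is bounded by [a] itself, so [P] is only asked to be closed under joins of
   nonempty chains. *)
- have [[t0 At0]|A0] := pselect (exists t, A t); last first.
    by exists (exist _ a (conj Pa (lexx a))) => s As; case: A0; exists s.
  pose B := [set sval t | t in A].
  have PB : P (Join B).
    apply: Pchain => [_ [t _ <-]||_ _ [s As <-] [t At <-]].
    + by case: (svalP t).
    + by exists (sval t0), t0.
    + exact: Atot.
  have aB : a <= Join B.
    by apply: (@le_trans _ _ (sval t0)); [case: (svalP t0)|apply: le_Join; exists t0].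
  by exists (exist _ (Join B) (conj PB aB)) => s As; apply: le_Join; exists s.
- exists p; split=> // b Pb pb.
  by have /(_ pb) [] := pmax (exist _ b (conj Pb (le_trans ap pb))).
Qed.

Lemma zorn_below (P : set L) a :
  P a -> (forall A, A `<=` P -> A !=set0 -> chain A -> P (Meet A)) ->
  exists p, [/\ P p, p <= a & forall b, P b -> b <= p -> b = p].
Proof.
move=> Pa Pchain.
pose T := {x : L | P x /\ x <= a}.
pose R (x y : T) := sval y <= sval x.
have [| | | A Atot|[p [Pp pa]] pmin] := @Zorn T R.
- by move=> x; exact: lexx.
- by move=> x y z xy yz; exact: le_trans yz xy.
- by move=> [x ?] [y ?] xy yx; apply/eq_exist/le_anti/andP.
- have [[t0 At0]|A0] := pselect (exists t, A t); last first.
    by exists (exist _ a (conj Pa (lexx a))) => s As; case: A0; exists s.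
  pose B := [set sval t | t in A].
  have PB : P (Meet B).
    apply: Pchain => [_ [t _ <-]||_ _ [s As <-] [t At <-]].
    + by case: (svalP t).
    + by exists (sval t0), t0.
    + by case: (Atot _ _ As At); [right|left].
  have Ba : Meet B <= a.
    by apply: (@le_trans _ _ (sval t0)); [apply: Meet_le; exists t0|case: (svalP t0)].
  by exists (exist _ (Meet B) (conj PB Ba)) => s As; apply: Meet_le; exists s.
- exists p; split=> // b Pb bp.
  by have /(_ bp) [] := pmin (exist _ b (conj Pb (le_trans bp pa))).
Qed.

End CompleteLattices.

(** * Residuals, principal elements and primes in multiplicative lattices *)

Section MultLattices.
Context {d : Order.disp_t} {L : multLatticeType d}.
Implicit Types (a b c e f p q t x y z : L) (A E F S : set L).

Lemma mulxUr x y z : x * (y `|` z) = (x * y) `|` (x * z).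
Proof. by rewrite -!Join_set2 mulx_Join image_setU !image_set1. Qed.

Lemma mulxUl x y z : (y `|` z) * x = (y * x) `|` (z * x).
Proof. by rewrite -!(mulxC x) mulxUr. Qed.

Lemma mulx_le2l x y z : y <= z -> x * y <= x * z.
Proof. by move=> /join_idPr <-; rewrite mulxUr leUl. Qed.

Lemma mulx_le2r x y z : y <= z -> y * x <= z * x.
Proof. by rewrite -!(mulxC x); exact: mulx_le2l. Qed.

Lemma mulx_le x y z t : x <= z -> y <= t -> x * y <= z * t.
Proof. by move=> xz yt; exact: le_trans (mulx_le2r _ xz) (mulx_le2l _ yt). Qed.

Lemma le_mul1 x : x <= 1.
Proof. by rewrite one_top lex1. Qed.

Lemma mulx_lel x y : x * y <= x.
Proof. by rewrite -[leRHS]mulg1 mulx_le2l ?le_mul1. Qed.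

Lemma mulx_ler x y : x * y <= y.
Proof. by rewrite mulxC mulx_lel. Qed.

Lemma mulx0 x : x * \bot = \bot.
Proof. by apply/le_anti; rewrite mulx_ler le0x. Qed.

Lemma mul0x x : \bot * x = \bot.
Proof. by rewrite mulxC mulx0. Qed.

Lemma mulxCA x y z : x * (y * z) = y * (x * z).
Proof. by rewrite !mulgA (mulxC x). Qed.

Lemma mulxAC x y z : x * y * z = x * z * y.
Proof. by rewrite -!mulgA (mulxC y). Qed.

Lemma expx_le_exp x n k : (n <= k)%N -> x ^+ k <= x ^+ n.
Proof. by move=> nk; rewrite -(subnK nk) expgnDr mulx_ler. Qed.

Lemma le_residual x a b : (x <= residual a b) = (x * b <= a).
Proof.
apply/idP/idP => [xab|]; last exact: le_Join.
apply: le_trans (mulx_le2r b xab) _; rewrite mulxC mulx_Join.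
by apply: Join_le => _ [y yab <-]; rewrite mulxC.
Qed.

Lemma residual_mul_le a b : residual a b * b <= a.
Proof. by rewrite -le_residual. Qed.

Lemma residual_mul a b c : residual a (b * c) = residual (residual a b) c.
Proof.
have mulE y : y * c * b = y * (b * c) by rewrite -mulgA (mulxC c).
apply/le_anti/andP; split; first by rewrite !le_residual mulE -le_residual.
by rewrite le_residual -mulE -!le_residual.
Qed.

Lemma prod_le_mem (s : seq L) x : x \in s -> \prod_(p <- s) p <= x.
Proof.
elim: s => // y s IH; rewrite inE big_cons => /predU1P[->|/IH]; first exact: mulx_lel.
exact: le_trans (mulx_ler _ _).
Qed.

Lemma prod_le_exp (s : seq L) x :
  {in s, forall p, p <= x} -> \prod_(p <- s) p <= x ^+ size s.
Proof.
elim: s => [|y s IH] sx; first by rewrite big_nil.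
by rewrite big_cons /= expgS mulx_le ?sx ?mem_head ?IH// => z zs; rewrite sx ?inE ?zs ?orbT.
Qed.

Lemma exp_le_prod (s : seq L) x :
  {in s, forall p, x <= p} -> x ^+ size s <= \prod_(p <- s) p.
Proof.
elim: s => [|y s IH] sx; first by rewrite big_nil.
by rewrite big_cons /= expgS mulx_le ?sx ?mem_head ?IH// => z zs; rewrite sx ?inE ?zs ?orbT.
Qed.

Lemma prime_mul p x y : prime_elt p -> x * y <= p -> x <= p \/ y <= p.
Proof. by case=> _; apply. Qed.

Lemma prime_neg1 p : prime_elt p -> ~ 1 <= p.
Proof. by case; rewrite /proper_elt one_top ltx1 le1x => /negP. Qed.

Lemma prime_exp p x n : prime_elt p -> x ^+ n <= p -> x <= p.
Proof.
move=> pP; elim: n => [/prime_neg1//|n IH]; rewrite expgS.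
by case/(prime_mul pP).
Qed.

Lemma prime_prod p (s : seq L) :
  prime_elt p -> \prod_(x <- s) x <= p -> exists2 x, x \in s & x <= p.
Proof.
move=> pP; elim: s => [|x s IH]; first by rewrite big_nil => /prime_neg1.
rewrite big_cons => /(prime_mul pP)[xp|/IH[y ys yp]].
  by exists x; rewrite ?mem_head.
by exists y; rewrite // inE ys orbT.
Qed.

Lemma prime_TA p : prime_elt p -> TA_elt p.
Proof.
move=> pP; split; first by case: pP.
move=> a b c /(prime_mul pP)[/(prime_mul pP)[ap|bp]|cp].
- by constructor 1; apply: le_trans (mulx_lel _ _) ap.
- by constructor 2; apply: le_trans (mulx_lel _ _) bp.
- by constructor 2; apply: le_trans (mulx_ler _ _) cp.
Qed.

Lemma TA_sqr t e n : TA_elt t -> e ^+ n.+2 <= t -> e ^+ 2 <= t.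
Proof.
move=> [_ tTA]; elim: n => // n IH.
by rewrite expgS (expgS _ n.+1) mulgA => /tTA[//|/IH//|]; rewrite -expgS.
Qed.

Lemma TA_exp_mul t e x n :
  TA_elt t -> e ^+ n * x <= t -> e ^+ 2 <= t \/ e * x <= t.
Proof.
move=> tTA; elim: n => [|[_|n IH]]; first 2 last.
- rewrite expgS => /(proj2 tTA)[|/IH//|]; last by right.
  by rewrite -expgS => /(TA_sqr tTA); left.
- by rewrite expg0 mul1g => xt; right; apply: le_trans (mulx_ler _ _) xt.
- by rewrite expg1; right.
Qed.

Lemma principal_le x e : principal_elt e -> x <= e -> x = residual x e * e.
Proof.
move=> /(_ x 1)[+ _] /meet_idPl xe.
by rewrite mul1g xe => {1}->; rewrite one_top meetx1.
Qed.

Lemma principal_residual a b e :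
  principal_elt e -> residual (a `|` (b * e)) e = residual a e `|` b.
Proof. by case/(_ a b). Qed.

Lemma principal1 : principal_elt (1 : L).
Proof.
have res1 a : residual a 1 = a.
  apply/le_anti/andP; split; last by rewrite le_residual mulg1.
  by rewrite -[leLHS]mulg1 residual_mul_le.
by move=> a b; rewrite !res1 !mulg1.
Qed.

Lemma principalM e f : principal_elt e -> principal_elt f -> principal_elt (e * f).
Proof.
move=> eP fP a b; rewrite (mulxC e) !residual_mul !mulgA mulxAC.
have [-> ->] := fP a (b * e); have [/esym E1 E2] := eP (residual a f) b.
by rewrite E2 (mulxAC _ f) E1.
Qed.

Lemma principalX e n : principal_elt e -> principal_elt (e ^+ n).
Proof.
move=> eP; elim: n => [|n IH]; first exact: principal1.
by rewrite expgS; exact: principalM.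
Qed.

Lemma principal_prod (s : seq L) :
  {in s, forall e, principal_elt e} -> principal_elt (\prod_(e <- s) e).
Proof.
elim: s => [|e s IH] sP; first by rewrite big_nil; exact: principal1.
rewrite big_cons; apply: principalM; first by apply: sP; rewrite mem_head.
by apply: IH => x xs; apply: sP; rewrite inE xs orbT.
Qed.

(* [e] stays cancellable in L/q, although [q v e] may fail to be principal     *)
(* there since L need not be modular.                                          *)
Lemma prime_join_cancel q b c e :
  prime_elt q -> principal_elt e -> ~ e <= q ->
  c * e <= q `|` (b * e) -> c <= q `|` b.
Proof.
move=> qP eP eq; rewrite -le_residual principal_residual// => /le_trans; apply.
rewrite leUx leUr andbT; apply: le_trans (leUl _ _).
by have [|//] := prime_mul qP (residual_mul_le q e).
Qed.

Lemma prod_split (P : pred L) (s : seq L) :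
  \prod_(x <- s) x = \prod_(x <- filter P s) x * \prod_(x <- filter (predC P) s) x.
Proof.
elim: s => [|x s IH]; first by rewrite !big_nil mulg1.
by rewrite /= big_cons IH; case: (P x) => /=; rewrite big_cons; [rewrite mulgA|rewrite mulxCA].
Qed.

Lemma compact_directed c A :
  compact_elt c -> A !=set0 ->
  (forall x y, A x -> A y -> exists z, [/\ A z, x <= z & y <= z]) ->
  c <= Join A -> exists2 x, A x & c <= x.
Proof.
move=> cc [a0 Aa0] Adir /cc[E [/finite_seqP[s ->] sA cs]].
suff [x Ax sx] : exists2 x, A x & forall y, y \in s -> y <= x.
  by exists x => //; apply: le_trans cs (Join_le _).
elim: s sA {cs} => [|y s IH] sA; first by exists a0.
have [z zs|x Ax sx] := IH; first by apply: sA => /=; rewrite inE zs orbT.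
have [|z [Az xz yz]] := Adir x y Ax; first by apply: sA => /=; rewrite mem_head.
exists z => // t; rewrite inE => /predU1P[->//|/sx tx]; exact: le_trans tx xz.
Qed.

Lemma compact_chain c A :
  compact_elt c -> A !=set0 -> chain A -> c <= Join A -> exists2 x, A x & c <= x.
Proof.
move=> cc A0 Atot; apply: compact_directed => // x y Ax Ay.
by have [xy|yx] := Atot _ _ Ax Ay; [exists y|exists x].
Qed.

(** Compactness of the members of [S] makes avoidance pass to joins of chains. A maximal avoiding
    [p] is prime: otherwise members of [S] lie below [p] joined with [x] and [p] joined with [y],
    and their product lies below [p] because [x * y] does. *)
Lemma zorn_avoid S a :
  mult_closed S -> S `<=` compact_elt -> (forall s, S s -> ~ s <= a) ->
  exists p, [/\ prime_elt p, a <= p, forall s, S s -> ~ s <= p &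
    forall b, (forall s, S s -> ~ s <= b) -> p <= b -> b = p].
Proof.
move=> [S1 SM] Sc aS; pose avoid b := forall s, S s -> ~ s <= b.
have [//|A AP A0 Atot s Ss|p [pS ap pmax]] := @zorn_above _ _ avoid a.
  by move=> /(compact_chain (Sc _ Ss) A0 Atot)[x /AP/(_ _ Ss)].
exists p; split=> //; split.
  by rewrite /proper_elt ltx1; apply/eqP => p1; apply: (pS _ S1); rewrite p1 lex1.
move=> x y xyp; apply: contrapT => /not_orP[xp yp].
have meets z : ~ z <= p -> exists2 s, S s & s <= p `|` z.
  move=> zp; apply: contrapT => /forall2NP Sz; apply: zp.
  rewrite -(pmax (p `|` z)) ?leUr ?leUl// => s Ss sz.
  by have [] := Sz s.
have [s Ss sx] := meets _ xp; have [t St ty] := meets _ yp.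
apply: (pS _ (SM _ _ Ss St)); apply: le_trans (mulx_le sx ty) _.
rewrite mulxUl !mulxUr !leUx xyp mulx_lel !andbT /=.
by rewrite mulx_lel mulx_ler.
Qed.

Definition minimal_prime a p : Prop :=
  [/\ prime_elt p, a <= p & forall q, prime_elt q -> a <= q -> q <= p -> q = p].

(** Zorn's lemma applies downwards because the meet of a nonempty chain of primes is prime. *)
Lemma minimal_prime_exists a q :
  prime_elt q -> a <= q -> exists p, minimal_prime a p.
Proof.
move=> qP aq.
have [||p [[pP ap] _ pmin]] := @zorn_below _ _ (fun x => prime_elt x /\ a <= x) q.
- by [].
- move=> A AP [x0 Ax0] Atot; split; last by apply: le_Meet => x /AP[].
  split; first by have [[x0p _] _] := AP _ Ax0; apply: le_lt_trans x0p; exact: Meet_le.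
  move=> x y xy; apply: contrapT => /not_orP[xA yA].
  have out z : ~ z <= Meet A -> exists2 p, A p & ~ z <= p.
    move=> zA; apply: contrapT => /forall2NP Az; apply: zA; apply: le_Meet => p Ap.
    by have [//|/contrapT] := Az p.
  have [p Ap xp] := out _ xA; have [r Ar yr] := out _ yA.
  have [pP _] := AP _ Ap; have [rP _] := AP _ Ar.
  have [pr|rp] := Atot _ _ Ap Ar.
    have [//|yp] := prime_mul pP (le_trans xy (Meet_le Ap)).
    by apply: yr; exact: le_trans yp pr.
  have [xr|//] := prime_mul rP (le_trans xy (Meet_le Ar)).
  by apply: xp; exact: le_trans xr rp.
- by exists p; split=> // r rP ar rp; exact: pmin.
Qed.

Lemma maximal_prime p : maximal_elt p -> prime_elt p.
Proof.
move=> [pp pmax]; split=> // x y xy; apply: contrapT => /not_orP[xp yp].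
have top z : ~ z <= p -> p `|` z = 1.
  move=> zp; rewrite one_top; apply: pmax; rewrite lex1 andbT lt_neqAle leUl andbT.
  by apply/eqP => E; apply: zp; rewrite E leUr.
have : (p `|` x) * (p `|` y) <= p.
  by rewrite mulxUl !mulxUr !leUx xy !andbT /= mulx_lel mulx_lel mulx_ler.
by rewrite !top// mulg1 one_top le1x => /eqP E; move: pp; rewrite /proper_elt E ltxx.
Qed.

End MultLattices.

(** * Cancellation, factors of principal elements, and localization *)

Section QuasiLocalDomain.
Context {d : Order.disp_t} {L : multLatticeType d} {m : L}.
Context (domL : C_lattice_domain L) (prinL : principally_generated L).
Context (locL : quasi_local m).
Implicit Types (a b c e f p q t x y z : L) (A E F S : set L).

Let prime0 : prime_elt (\bot : L).
Proof. by case: domL. Qed.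

Lemma proper_le_max x : x <> 1 -> x <= m.
Proof.
case: locL => c1 _ mmax x1; pose P (y : L) := y <> \top.
have [|A AP A0 Atot A1|p [pP xp pmax]] := @zorn_above _ _ P x.
- by rewrite /P -one_top.
- have [|y /AP + y1] := compact_chain c1 A0 Atot; first by rewrite A1.
  by apply; apply/eqP; rewrite -le1x.
- suff <- : p = m by [].
  apply: mmax; split; first by rewrite /proper_elt ltx1; apply/eqP.
  move=> y /andP[py _]; apply: contrapT => yP.
  by move: (py); rewrite (pmax y yP (ltW py)) ltxx.
Qed.

Lemma max_prime : prime_elt m.
Proof. by case: locL => _ /maximal_prime. Qed.

Lemma proper_le x : proper_elt x -> x <= m.
Proof. by move=> xp; apply: proper_le_max => x1; move: xp; rewrite x1 /proper_elt one_top ltxx. Qed.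

Lemma max_lt1 : ~ 1 <= m.
Proof. exact/prime_neg1/max_prime. Qed.

Lemma le_max_proper x : x <= m -> proper_elt x.
Proof. by move=> xm; apply: le_lt_trans xm _; case: max_prime. Qed.

Lemma principal_cancel e x y : principal_elt e -> e <> \bot -> x * e <= y * e -> x <= y.
Proof.
move=> eP e0 xy; rewrite -[y]join0x.
apply: (prime_join_cancel prime0 eP); last by rewrite join0x.
by rewrite lex0 => /eqP.
Qed.

Lemma principal_cancel_eq e x y : principal_elt e -> e <> \bot -> x * e = y * e -> x = y.
Proof.
by move=> eP e0 xy; apply/le_anti/andP; split; apply: (principal_cancel eP e0); rewrite xy.
Qed.

Lemma mul_neq0 x y : x <> \bot -> y <> \bot -> x * y <> \bot.
Proof.
move=> x0 y0 xy; have := prime_mul prime0 (x := x) (y := y).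
by rewrite xy lexx !lex0 => /(_ isT)[] /eqP.
Qed.

(** Nakayama's argument: each [f] in [F] is a multiple of [e]. If [e] is not in [F], all the
    cofactors are at most [m], so [e <= m * e], and cancelling [e] gives [1 <= m]. *)
Lemma principal_Join_irr e F : principal_elt e -> e <> \bot -> e = Join F -> F e.
Proof.
move=> eP e0 eF; apply: contrapT => Fe; apply: max_lt1.
apply: (principal_cancel eP e0); rewrite mul1g {1}eF.
apply: Join_le => f Ff; have fe : f <= e by rewrite eF; exact: le_Join.
rewrite (principal_le eP fe); apply/mulx_le2r/proper_le_max => fe1.
by apply: Fe; rewrite (_ : e = f)//; rewrite (principal_le eP fe) fe1 mul1g.
Qed.

(** A nonzero [e] is a join of compact elements, hence by join-irreducibility one of them. *)
Lemma principal_compact e : principal_elt e -> compact_elt e.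
Proof.
move=> eP; have [->|/eqP e0] := eqVneq e \bot.
  by move=> F _; exists set0; split=> //; exact: le0x.
have [[C [_ Cc Cgen]] _] := domL; have [E EC eE] := Cgen e.
exact: Cc (EC _ (principal_Join_irr eP e0 eE)).
Qed.

Lemma principal_gen x : x = Join [set e | principal_elt e /\ e <= x].
Proof.
apply/le_anti/andP; split; last by apply: Join_le => e [].
have [E EP xE] := prinL x; rewrite [leLHS]xE; apply: Join_subset => e Ee.
by split; [exact: EP|rewrite xE; exact: le_Join].
Qed.

Lemma le_principal x y : (forall e, principal_elt e -> e <= x -> e <= y) -> x <= y.
Proof. by move=> xy; rewrite (principal_gen x); apply: Join_le => e [/xy]. Qed.

Lemma not_le_principal x y : ~ x <= y -> exists e, [/\ principal_elt e, e <= x & ~ e <= y].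
Proof.
move=> xy; apply: contrapT => H; apply: xy; apply: le_principal => e eP ex.
by apply: contrapT => ey; apply: H; exists e.
Qed.

Lemma neq0_principal x : x <> \bot -> exists e, [/\ principal_elt e, e <= x & e <> \bot].
Proof.
move=> x0; have [|e [eP ex e0]] := @not_le_principal x \bot.
  by rewrite lex0; apply/negP/eqP.
by exists e; split=> // e00; apply: e0; rewrite e00.
Qed.

Lemma mul_principal_gen x y : x * y =
  Join [set z | exists e f, [/\ principal_elt e, principal_elt f, e <= x, f <= y & z = e * f]].
Proof.
apply/le_anti/andP; split; last first.
  by apply: Join_le => _ [e [f [_ _ ex fy ->]]]; exact: mulx_le.
rewrite {1}(principal_gen y) mulx_Join; apply: Join_le => _ [f [fP fy] <-].
rewrite mulxC {1}(principal_gen x) mulx_Join; apply: Join_le => _ [e [eP ex] <-].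
by rewrite mulxC; apply: le_Join; exists e, f.
Qed.

(** By join-irreducibility [x * y] equals some [e * f] with [e <= x] and [f <= y] principal.
    Squeezing gives [x * f = e * f] and [e * y = e * f], and cancellation gives [x = e] and
    [y = f]. *)
Lemma principal_factor x y :
  principal_elt (x * y) -> x * y <> \bot -> principal_elt x /\ principal_elt y.
Proof.
move=> xyP xy0; have [e [f [eP fP ex fy xyE]]] := principal_Join_irr xyP xy0 (mul_principal_gen x y).
have xf : x * f = e * f.
  by apply/le_anti; rewrite (mulx_le2r f ex) andbT -xyE mulx_le2l.
have ey : e * y = e * f.
  by apply/le_anti; rewrite (mulx_le2l e fy) andbT -xyE mulx_le2r.
have e0 : e <> \bot by move=> e0; apply: xy0; rewrite xyE e0 mul0x.
have f0 : f <> \bot by move=> f0; apply: xy0; rewrite xyE f0 mulx0.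
have -> : x = e by exact: principal_cancel_eq xf.
have -> : y = f by apply: (principal_cancel_eq eP e0); rewrite -!(mulxC e).
by [].
Qed.

Lemma principal_prod_factor (s : seq L) x :
  principal_elt (\prod_(y <- s) y) -> \prod_(y <- s) y <> \bot -> x \in s -> principal_elt x.
Proof.
elim: s => // y s IH; rewrite big_cons inE => ysP ys0.
have [yP sP] := principal_factor ysP ys0.
case/predU1P => [->//|]; apply: IH => // s0; apply: ys0.
by rewrite s0 mulx0.
Qed.

(* [x <= b] in the localization of L at the prime [p], when [x] is compact.     *)
Definition loc_le p b x : Prop :=
  exists s, [/\ principal_elt s, ~ s <= p & s * x <= b].

(** The localized order for arbitrary [a]. It is tested on principal elements since these are
    compact, so that one multiplier [s] is enough for each. *)
Definition loc_sub p a b : Prop :=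
  forall x, principal_elt x -> x <= a -> loc_le p b x.

Lemma loc_leM p b c x y :
  prime_elt p -> loc_le p b x -> loc_le p c y -> loc_le p (b * c) (x * y).
Proof.
move=> pP [s [sP sp sx]] [t [tP tp ty]]; exists (s * t).
split; [exact: principalM|by case/(prime_mul pP)|].
by rewrite -mulgA (mulxCA t) mulgA mulx_le.
Qed.

Lemma loc_le_Join p b x F : prime_elt p -> principal_elt x ->
  x <= Join F -> (forall f, F f -> loc_le p b f) -> loc_le p b x.
Proof.
move=> pP /principal_compact + /[swap] Fb => /[apply] -[E [/finite_seqP[fs ->] fsF xfs]].
suff [s [sP sp sfs]] : exists s, [/\ principal_elt s, ~ s <= p & forall f, f \in fs -> s * f <= b].
  exists s; split=> //; apply: le_trans (mulx_le2l s xfs) _.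
  by rewrite mulx_Join; apply: Join_le => _ [f /sfs ffs <-].
elim: fs fsF {xfs} => [|f fs IH] fsF.
  by exists 1; split=> //; [exact: principal1|exact: prime_neg1].
have [g gfs|s [sP sp sfs]] := IH; first by apply: fsF => /=; rewrite inE gfs orbT.
have [|t [tP tp tf]] := Fb f; first by apply: fsF => /=; rewrite mem_head.
exists (s * t); split; [exact: principalM|by case/(prime_mul pP)|].
move=> g; rewrite inE => /predU1P[->|/sfs sg].
  by rewrite -mulgA; apply: le_trans (mulx_ler _ _) tf.
by rewrite mulxAC; apply: le_trans (mulx_lel _ _) sg.
Qed.

Lemma le_loc_sub p a b : prime_elt p -> a <= b -> loc_sub p a b.
Proof.
move=> pP ab x xP xa; exists 1; split; [exact: principal1|exact: prime_neg1|].
by rewrite mul1g (le_trans xa).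
Qed.

Lemma loc_sub_trans p a b c : prime_elt p -> loc_sub p a b -> loc_sub p b c -> loc_sub p a c.
Proof.
move=> pP ab bc x xP /(ab _ xP)[s [sP sp /bc[|t [tP tp tsx]]]]; first exact: principalM.
by exists (t * s); split; [exact: principalM|case/(prime_mul pP)|rewrite -mulgA].
Qed.

Lemma loc_subM p a b a' b' : prime_elt p ->
  loc_sub p a b -> loc_sub p a' b' -> loc_sub p (a * a') (b * b').
Proof.
move=> pP ab ab' x xP; rewrite mul_principal_gen => /(loc_le_Join pP xP); apply.
by move=> _ [e [f [eP fP /(ab _ eP) eb /(ab' _ fP) fb ->]]]; exact: loc_leM.
Qed.

Lemma loc_sub_prod p a (s : seq L) : prime_elt p ->
  {in s, forall t, loc_sub p a t} -> loc_sub p (a ^+ size s) (\prod_(t <- s) t).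
Proof.
move=> pP; elim: s => [|t s IH] sa; first by rewrite big_nil; exact: le_loc_sub.
rewrite /= expgS big_cons; apply: loc_subM => //; first by apply: sa; rewrite mem_head.
by apply: IH => u us; apply: sa; rewrite inE us orbT.
Qed.

(** Otherwise a prime above [a] avoids all [x ^+ n * s]. With [n = 0] it lies below [p], so it is
    [p] by minimality; but it does not contain [x]. *)
Lemma minimal_prime_power p a x : minimal_prime a p -> principal_elt x -> x <= p ->
  exists s n, [/\ principal_elt s, ~ s <= p & x ^+ n * s <= a].
Proof.
move=> [pP ap pmin] xP xp; apply: contrapT => H.
pose S := [set z | exists s n, [/\ principal_elt s, ~ s <= p & z = x ^+ n * s]].
have [||s|q [qP aq qS _]] := @zorn_avoid _ _ S a.
- split; first by exists 1, 0%N; split; [exact: principal1|exact: prime_neg1|rewrite mulg1].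
  move=> _ _ [s [n [sP sp ->]]] [t [k [tP tp ->]]]; exists (s * t), (n + k)%N.
  split; [exact: principalM|by case/(prime_mul pP)|].
  by rewrite expgnDr -!mulgA (mulxCA s).
- move=> _ [s [n [sP _ ->]]]; apply/principal_compact/principalM => //.
  exact: principalX.
- by move=> [t [n [tP tp ->]]] H'; apply: H; exists t, n.
- have qp : q <= p.
    apply: le_principal => s sP sq; apply: contrapT => sp.
    by apply: (qS s) => //; exists s, 0%N; rewrite mul1g.
  apply: (qS x); last by rewrite (pmin q).
  by exists 1, 1%N; split; [exact: principal1|exact: prime_neg1|rewrite mulg1].
Qed.

(* The absorbing property is applied to [s x], [x v y] and [y], where [s x^2]  *)
(* and [s y^2] lie below [t].                                                  *)
Lemma TA_minimal_prime p a t :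
  minimal_prime a p -> a <= t -> TA_elt t -> loc_sub p (p ^+ 2) t.
Proof.
move=> pmin at_ tTA; have [pP ap _] := pmin.
have sqr x : principal_elt x -> x <= p -> loc_le p t (x * x).
  move=> xP xp; have [s [n [sP sp xs]]] := minimal_prime_power pmin xP xp.
  exists s; split=> //; rewrite -expg2.
  have [xt|xst] := TA_exp_mul tTA (le_trans xs at_).
    by apply: le_trans (mulx_ler _ _) xt.
  by rewrite expg2 mulxCA; apply: le_trans (mulx_ler _ _) _; rewrite mulxC.
move=> z zP; rewrite expg2 mul_principal_gen => /(loc_le_Join pP zP); apply.
move=> _ [x [y [xP yP xp yp ->]]].
have [s [sP sp sx]] := sqr _ xP xp; have [u [uP up uy]] := sqr _ yP yp.
exists (s * u); split; [exact: principalM|by case/(prime_mul pP)|].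
have [||H|] := proj2 tTA (s * u * x) (x `|` y) y.
- rewrite mulxUr mulxUl leUx; apply/andP; split.
    have -> : s * u * x * x * y = s * (x * x) * (u * y).
      by rewrite -!mulgA (mulxCA u) (mulxCA u x).
    by apply: le_trans (mulx_lel _ _) sx.
  have -> : s * u * x * y * y = u * (y * y) * (s * x).
    by rewrite (mulxC (u * _)) -!mulgA (mulxCA u x).
  by apply: le_trans (mulx_lel _ _) uy.
- rewrite -mulgA; apply: le_trans; apply: mulx_le2l; apply: mulx_le2l; exact: leUr.
- by apply: le_trans (mulx_ler _ _) (le_trans (mulx_le2r y (leUl x y)) H).
- by rewrite -mulgA.
Qed.

End QuasiLocalDomain.

(** * TAFL forces dimension at most one *)

Section Dimension.
Context {d : Order.disp_t} {L : multLatticeType d} {m : L}.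
Context (domL : C_lattice_domain L) (prinL : principally_generated L).
Context (locL : quasi_local m) (TAL : forall x : L, TA_product x).
Implicit Types (a b c e f p q r t x y z : L).

(** Each TA-factor of [p] joined with a high power of [e] is above [e ^+ 2]. If too few factors were
    below [q], they could be replaced by powers of [e ^+ 2] and cancelled, leaving the product of
    the others below [q]. *)
Lemma prime_le_exp p q n : prime_elt p -> prime_elt q -> p <= q -> ~ q <= p -> p <= q ^+ n.
Proof.
move=> pP qP pq /(not_le_principal prinL)[e [eP eq ep]].
case: n => [|n]; first exact: le_mul1.
have [s [sTA sE]] := TAL (p `|` (e ^+ (n.+1).*2)).
have e2 t : t \in s -> e ^+ 2 <= t.
  move=> ts; apply: (@TA_sqr _ _ _ _ n.*2 (sTA _ ts)).
  apply: (@le_trans _ _ (p `|` (e ^+ (n.+1).*2))); first by rewrite doubleS leUr.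
  by rewrite sE prod_le_mem.
have ps : p <= \prod_(t <- s) t by rewrite -sE leUl.
move: sE ps; rewrite (prod_split [pred t | t <= q]).
set s1 := filter _ s; set s2 := filter _ s => sE ps.
apply: le_trans ps (le_trans (mulx_lel _ _) _).
apply: le_trans (prod_le_exp (x := q) _) _; first by move=> t; rewrite mem_filter => /andP[].
apply: expx_le_exp; rewrite leqNgt; apply/negP => s1n.
have /(prime_prod qP)[t] : \prod_(t <- s2) t <= q.
  apply: (@le_trans _ _ (p `|` (e ^+ ((n.+1).*2 - (size s1).*2)))).
    apply: (prime_join_cancel (e := e ^+ (size s1).*2) pP).
    - exact: principalX.
    - by move=> /(prime_exp pP).
    - rewrite -expgnDr subnK ?leq_double 1?ltnW// sE mulxC mulx_le2r//.
      rewrite -mul2n expgnA; apply: exp_le_prod => t; rewrite mem_filter => /andP[_].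
      exact: e2.
  rewrite leUx pq /= -doubleB subSn //.
  by rewrite doubleS expgS; apply: le_trans (mulx_lel _ _) eq.
by rewrite mem_filter => /andP[/negP].
Qed.

Lemma principal_mem_prod x (s : seq L) p :
  prime_elt p -> x = \prod_(t <- s) t -> x <= p -> exists2 t, t \in s & x <= t <= p.
Proof.
move=> pP xE; rewrite xE => /(prime_prod pP)[t ts tp].
by exists t; rewrite // tp prod_le_mem.
Qed.

Lemma prime_bot p q : prime_elt p -> prime_elt q -> p <= q -> ~ q <= p -> p = \bot.
Proof.
move=> pP qP pq /(not_le_principal prinL)[e [eP eq ep]].
have [|r rmin] := minimal_prime_exists qP (a := p `|` e); first by rewrite leUx pq.
have [rP] := rmin; rewrite leUx => /andP[pr er] _ {q qP pq eq}.
apply: contrapT => p0.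
have rp : ~ r <= p by move=> rp; apply: ep; exact: le_trans er rp.
have below n : p <= r ^+ n by exact: prime_le_exp.
(* Locally idempotent [r]: then [r] is locally below every TA-factor of [p] joined with [e ^+ 3],
   hence below their product. *)
have [rr|] := pselect (loc_sub r r (r ^+ 2)).
  have rn n : loc_sub r r (r ^+ n).
    elim: n => [|n IH]; first by apply: le_loc_sub => //; exact: le_mul1.
    apply: loc_sub_trans rr _ => //; rewrite expg2 expgS.
    by apply: (loc_subM domL prinL locL) => //; exact: le_loc_sub.
  have r3min : minimal_prime (p `|` (e ^+ 3)) r.
    have [_ _ rP'] := rmin; split=> // [|q qP]; rewrite leUx.
      by rewrite pr (le_trans (expx_le_exp e (n := 1) _)).
    by move=> /andP[pq /(prime_exp qP) eq]; apply: rP'; rewrite // leUx pq.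
  have [s [sTA sE]] := TAL (p `|` (e ^+ 3)).
  have rs : loc_sub r r (p `|` (e ^+ 3)).
    rewrite sE; apply: loc_sub_trans (rn (size s)) _ => //.
    apply: (loc_sub_prod domL prinL locL) => // t ts.
    apply: loc_sub_trans rr _ => //.
    apply: (TA_minimal_prime domL prinL locL r3min); last exact: sTA.
    by rewrite sE prod_le_mem.
  have [u [uP ur]] := rs _ eP er.
  rewrite expgSr => /(prime_join_cancel pP eP ep) ue.
  apply: ur; apply: le_trans ue _; rewrite leUx pr expgS.
  exact: le_trans (mulx_lel _ _) er.
move=> /existsNP[f0 /not_implyP[f0P /not_implyP[f0r f0rr]]].
have zero_loc : loc_le r (r ^+ 2) \bot.
  by exists 1; split; [exact: principal1|exact: prime_neg1|rewrite mul1g le0x].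
have [f [fP fTA fr frr]] : exists f,
    [/\ principal_elt f, TA_elt f, f <= r & ~ loc_le r (r ^+ 2) f].
  have [s [sTA sE]] := TAL f0.
  have [f fs /andP[f0f fr]] := principal_mem_prod rP sE f0r.
  exists f; split=> //; last first.
  - move=> [u [uP ur uf]]; apply: f0rr; exists u; split=> //.
    exact: le_trans (mulx_le2l u f0f) uf.
  - exact: sTA.
  - apply: (principal_prod_factor domL prinL locL _ _ fs); rewrite -sE //.
    by move=> f00; apply: f0rr; rewrite f00.
have le_loc x : x <= r ^+ 2 -> loc_le r (r ^+ 2) x.
  by move=> xr; exists 1; split; [exact: principal1|exact: prime_neg1|rewrite mul1g].
(* A prime strictly below [r] lies below [r ^+ 2] by [prime_le_exp], so it cannot contain [f]. *)
have fmin : minimal_prime f r.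
  split=> // q qP fq qr; apply: contrapT => qr'; apply: frr; apply: le_loc.
  apply: le_trans fq _; apply: prime_le_exp => // rq.
  by apply: qr'; apply/le_anti; rewrite qr.
(* Write [u * x] as a multiple of [f]. A cofactor not below [r] would put [f] locally below
   [r ^+ 2]. *)
have rrf : loc_sub r (r ^+ 2) (f * r).
  move=> x xP xr.
  have [u [uP ur uxf]] := TA_minimal_prime domL prinL locL fmin (lexx f) fTA xP xr.
  exists u; split=> //; rewrite (principal_le fP uxf) mulxC; apply: mulx_le2l.
  apply: contrapT => /(not_le_principal prinL)[v [vP vuxf vr]]; apply: frr.
  exists v; split=> //; apply: le_trans (mulx_le2r f vuxf) _.
  by rewrite -(principal_le fP uxf); apply: le_trans (mulx_ler _ _) xr.
have rrrff : loc_sub r (r ^+ 3) (f * f).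
  have step : loc_sub r (r * r ^+ 2) (r * (f * r)).
    by apply: (loc_subM domL prinL locL) => //; exact: le_loc_sub.
  rewrite expgS; apply: loc_sub_trans step _ => //.
  apply: (@loc_sub_trans _ _ _ _ (f * (r ^+ 2))) => //.
    by apply: le_loc_sub => //; rewrite mulxCA expg2.
  apply: (@loc_sub_trans _ _ _ _ (f * (f * r))) => //.
    by apply: (loc_subM domL prinL locL) => //; exact: le_loc_sub.
  by apply: le_loc_sub => //; rewrite mulgA mulx_lel.
have fp : ~ f <= p by move=> fp; apply/frr/le_loc/(le_trans fp)/below.
have [x [xP xp x0]] := neq0_principal prinL p0.
have [s [sTA sE]] := TAL x.
have [t ts /andP[xt tp]] := principal_mem_prod pP sE xp.
have tP : principal_elt t.
  by apply: (principal_prod_factor domL prinL locL _ _ ts); rewrite -sE.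
have neq0 y z : y <= z -> y <> \bot -> z <> \bot.
  by move=> yz y0 z0; apply: y0; apply/eqP; rewrite -lex0 -z0.
have t0 : t <> \bot := neq0 _ _ xt x0.
have [u [uP ur ut]] := rrrff t tP (le_trans tp (below 3)).
have u0 : u <> \bot by move=> u0; apply: ur; rewrite u0 le0x.
have ffP : principal_elt (f * f) by exact: principalM.
have := principal_le ffP ut; set y := residual _ _ => utE.
have yff0 : y * (f * f) <> \bot by rewrite -utE; exact: (mul_neq0 domL).
have [yP _] : principal_elt y /\ principal_elt (f * f).
  by apply: (principal_factor domL prinL locL); rewrite // -utE; exact: principalM.
(* Absorption applies to [f * f * y], which is [u * t]; the alternative [f * f <= t] would give
   [f <= p]. *)
have fyt : f * y <= t.
  have [|fft|//|//] := proj2 (sTA _ ts) f f y.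
  - by rewrite mulxC -utE mulx_ler.
  - by have [/fp|/fp] := prime_mul pP (le_trans fft tp).
apply: ur; apply: le_trans fr.
apply: (@principal_cancel _ _ domL (f * y)); first exact: principalM.
  by apply: (neq0 _ _ _ yff0); rewrite mulxC -mulgA mulx_ler.
apply: le_trans (mulx_le2l u fyt) _.
by rewrite utE mulxC mulgA.
Qed.

End Dimension.

(** * Factorization when every nonzero prime is maximal *)

Section PrincipalFactorization.
Context {d : Order.disp_t} {L : multLatticeType d} {m : L}.
Context (domL : C_lattice_domain L) (prinL : principally_generated L).
Context (locL : quasi_local m).
Context (prime_max : forall p : L, prime_elt p -> p <> \bot -> p = m).
Context (PTAL : forall x : L, principal_elt x -> TA_product x).
Implicit Types (a b e t x y : L).

(** Here [m] is the minimal prime over [t], and localizing at [m] changes nothing: an element not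
    below [m] is [1]. *)
Lemma sqr_max_le_TA t : TA_elt t -> t <> \bot -> m ^+ 2 <= t.
Proof.
move=> tTA t0; have mP := max_prime locL.
have mmin : minimal_prime t m.
  split=> // [|q qP tq _]; first by apply: (proper_le locL); case: tTA.
  by apply: prime_max => // q0; apply: t0; apply/eqP; rewrite -lex0 -q0.
apply: (le_principal prinL) => x xP xm.
have [s [_ sm sx]] := TA_minimal_prime domL prinL locL mmin (lexx t) tTA xP xm.
suff s1 : s = 1 by rewrite s1 mul1g in sx.
by apply: contrapT => s1; apply: sm; exact: (proper_le_max locL).
Qed.

Lemma TA_sqr_max_le t : m ^+ 2 <= t -> t <= m -> TA_elt t.
Proof.
move=> m2t tm; split; first exact: (le_max_proper locL).
move=> a b c.
have [->|/eqP a1] := eqVneq a 1.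
  by rewrite mul1g; constructor 2.
have [->|/eqP b1] := eqVneq b 1.
  by rewrite mulg1; constructor 3.
move=> _; constructor 1; apply: le_trans m2t; rewrite expg2.
by apply: mulx_le; exact: (proper_le_max locL).
Qed.

(** In ring terms, [a] generates a principal reduction of the maximal ideal: multiplying [m] by [a]
    has the same effect as multiplying it by [m]. *)
Definition max_atom a : Prop := [/\ principal_elt a, a <= m & m * a = m ^+ 2].

Lemma max_atom_sqr_le a : max_atom a -> m ^+ 2 <= a.
Proof. by case=> _ _ <-; exact: mulx_ler. Qed.

Lemma prod_max_atom (s : seq L) : {in s, forall a, max_atom a} ->
  (\prod_(a <- s) a) * m = m ^+ (size s).+1.
Proof.
elim: s => [|a s IH] sA; first by rewrite big_nil mul1g.
have [_ _ ma] : max_atom a by apply: sA; rewrite mem_head.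
rewrite big_cons -mulgA IH; last by move=> b bs; apply: sA; rewrite inE bs orbT.
by rewrite expgS mulgA (mulxC a) ma -expgnDr.
Qed.

(** Write [m ^+ 2] as a multiple of [t]. If the cofactor is [1], then [t = m * m] and [m] is itself
    a principal atom; otherwise the cofactor is at most [m], and [t] is an atom. *)
Lemma TA_max_atoms t : principal_elt t -> TA_elt t -> t <> \bot ->
  exists s : seq L, {in s, forall a, max_atom a} /\ t = \prod_(a <- s) a.
Proof.
move=> tP tTA t0; have m2t := sqr_max_le_TA tTA t0.
have tm : t <= m by apply: (proper_le locL); case: tTA.
have [m2E|/eqP m2t'] := eqVneq (residual (m ^+ 2) t) 1.
  have tE : t = m * m.
    apply/le_anti; rewrite -expg2 m2t andbT.
    by rewrite -[t]mul1g -m2E residual_mul_le.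
  have [mP _] : principal_elt m /\ principal_elt m.
    by apply: (principal_factor domL prinL locL); rewrite -tE.
  exists [:: m; m]; split; last by rewrite !big_cons big_nil mulg1.
  by move=> a; rewrite !inE orbb => /eqP->; split.
exists [:: t]; split; last by rewrite big_cons big_nil mulg1.
move=> a; rewrite inE => /eqP->; split=> //; apply/le_anti/andP; split.
  by rewrite expg2 mulx_le2l.
rewrite {1}(principal_le tP m2t); apply: mulx_le2r.
exact: (proper_le_max locL).
Qed.

Lemma principal_max_atoms x : principal_elt x -> x <> \bot ->
  exists s : seq L, {in s, forall a, max_atom a} /\ x = \prod_(a <- s) a.
Proof.
move=> xP x0; have [ts [tsTA xE]] := PTAL xP.
have {}tsTA t : t \in ts -> [/\ principal_elt t, TA_elt t & t <> \bot].
  move=> tts; split.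
  - by apply: (principal_prod_factor domL prinL locL _ _ tts); rewrite -xE.
  - exact: tsTA.
  - move=> t0; apply: x0; apply/eqP; rewrite -lex0 xE -t0; exact: prod_le_mem.
rewrite {}xE {x xP x0}; elim: ts tsTA => [|t ts IH] tsTA.
  by exists [::].
have [tP tTA t0] := tsTA t (mem_head _ _).
have [s [sA sE]] := TA_max_atoms tP tTA t0.
have [u uts|s' [s'A s'E]] := IH; first by apply: tsTA; rewrite inE uts orbT.
exists (s ++ s'); rewrite big_cons big_cat sE s'E; split=> // a.
by rewrite mem_cat => /orP[/sA|/s'A].
Qed.

Lemma max_atoms_le_exp (s : seq L) : {in s, forall a, max_atom a} ->
  \prod_(a <- s) a <= m ^+ size s.
Proof. by move=> sA; apply: prod_le_exp => a /sA[]. Qed.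

(** A nonzero principal [x] with [k] atoms satisfies [x * m = m ^+ k.+1]. If [x] were below all
    powers, then [x <= x * m], and cancelling [x] would give [1 <= m]. *)
Lemma Meet_exp_max : Meet (range (fun n : nat => m ^+ n)) = \bot.
Proof.
set w := Meet _; apply: contrapT => /(neq0_principal prinL)[x [xP xw x0]].
have [s [sA xE]] := principal_max_atoms xP x0.
apply: (max_lt1 locL); apply: (principal_cancel domL xP x0).
rewrite mul1g mulxC {2}xE prod_max_atom//; apply: le_trans xw _.
by apply: Meet_le; exists (size s).+1.
Qed.

Lemma comparable_sqr_max : comparable_elt (m ^+ 2).
Proof.
move=> b; rewrite /Order.comparable; apply/orP.
have [bm|/negP/(not_le_principal prinL)[e [eP eb em]]] := boolP (b <= m ^+ 2); first by right.
left; apply: le_trans eb.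
have e0 : e <> \bot by move=> e0; apply: em; rewrite e0 le0x.
(* Two or more atoms would put [e] below [m ^+ 2], so there is at most one. *)
have [[|a [|a' s]] [sA eE]] := principal_max_atoms eP e0.
- by rewrite eE big_nil le_mul1.
- by rewrite eE big_cons big_nil mulg1; apply: max_atom_sqr_le; apply: sA; rewrite mem_head.
- case: em; rewrite eE; apply: le_trans (max_atoms_le_exp sA) _.
  exact: expx_le_exp.
Qed.

Lemma TA_product_all x : TA_product x.
Proof.
have [->|/eqP x0] := eqVneq x \bot.
  exists [:: \bot]; rewrite big_cons big_nil mulg1; split=> // p.
  by rewrite inE => /eqP->; apply: prime_TA; case: domL.
(* The least number [k] of atoms in a nonzero product below [x] bounds [x] by [m ^+ k]. *)
pose P k := `[< exists s : seq L,
  [/\ size s = k, {in s, forall a, max_atom a}, \prod_(a <- s) a <= x &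
      \prod_(a <- s) a <> \bot] >].
have exP : exists k, P k.
  have [e [eP ex e0]] := neq0_principal prinL x0.
  have [s [sA eE]] := principal_max_atoms eP e0.
  by exists (size s); apply/asboolP; exists s; rewrite -eE.
case: (ex_minnP exP) => k /asboolP[s [sk sA sx sn0]] kmin.
case: s => [|a s] in sk sA sx sn0 *.
  exists [::]; rewrite big_nil; split=> //; apply/le_anti; rewrite le_mul1.
  by rewrite big_nil in sx.
have aA : max_atom a by apply: sA; rewrite mem_head.
have {}sA : {in s, forall a, max_atom a} by move=> b bs; apply: sA; rewrite inE bs orbT.
have sP : principal_elt (\prod_(b <- s) b) by apply: principal_prod => b /sA[].
have s0 : \prod_(b <- s) b <> \bot.
  by move=> s0; apply: sn0; rewrite big_cons s0 mulx0.
have xs : x <= m * \prod_(b <- s) b.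
  rewrite mulxC prod_max_atom//; apply: (le_principal prinL) => e eP ex.
  have [->|/eqP e0] := eqVneq e \bot; first exact: le0x.
  have [s' [s'A eE]] := principal_max_atoms eP e0.
  rewrite {1}eE; apply: le_trans (max_atoms_le_exp s'A) _; apply: expx_le_exp.
  by move: sk => /= ->; apply: kmin; apply/asboolP; exists s'; rewrite -eE.
have xs' := le_trans xs (mulx_ler _ _).
(* All atoms but [a] are split off from [x]. The remaining factor [y] satisfies [a <= y <= m], so it
   lies between [m ^+ 2] and [m]. *)
have xE := principal_le sP xs'; set y := residual _ _ in xE.
exists (y :: s); rewrite big_cons; split=> // b; rewrite inE => /predU1P[->|/sA bA].
  apply: TA_sqr_max_le.
    apply: le_trans (max_atom_sqr_le aA) _.
    by rewrite /y le_residual; rewrite big_cons in sx.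
  by apply: (principal_cancel domL sP s0); rewrite -xE.
by apply: TA_sqr_max_le; [exact: max_atom_sqr_le|case: bA].
Qed.

End PrincipalFactorization.

(** * Dimension in terms of prime chains *)

Section PrimeChains.
Context {d : Order.disp_t} {L : multLatticeType d}.

Lemma dimension_le1P :
  (dimension L <= 1)%E <-> forall n, prime_chain L n -> (n <= 1)%N.
Proof.
rewrite /dimension; set A := image _ _; split=> [dim1 n Ln|L1]; last first.
  rewrite /supremum; case: ifPn => _; first exact: leNye.
  case: xgetP => [y _ [_]|_]; last exact: leNye.
  by apply=> _ [n /L1 n1 <-]; rewrite lee_fin lez_nat.
(* [supremum] falls back to [-oo] when no least upper bound exists, so one must be exhibited: the
   maximal chain length if lengths are bounded, [+oo] otherwise. *)
suff /(@ge_supremum_Nmem _ _ -oo%E _ (n%:Z)%:E) : supremums A !=set0.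
  have An : A (n%:Z)%:E by exists n.
  by move=> /(_ An) /le_trans /(_ dim1); rewrite lee_fin lez_nat.
have [[N LN]|unbounded] := pselect (exists N, forall k, prime_chain L k -> (k <= N)%N).
  have exL : exists k, `[< prime_chain L k >] by exists n; apply/asboolP.
  have [k /asboolP|k /asboolP Lk kmax] := ex_maxnP exL (m := N); first exact: LN.
  exists (k%:Z)%:E; split=> [_ [j Lj <-]|u]; last by apply; exists k.
  by rewrite lee_fin lez_nat; apply: kmax; apply/asboolP.
exists +oo%E; split=> [x _|u uA]; first exact: leey.
case: u uA => [r||] uA; last 2 first.
- by [].
- by have := uA (n%:Z)%:E (imageP _ Ln).
exfalso; apply: unbounded; exists `|r|%N => k Lk.
have := uA (k%:Z)%:E (imageP _ Lk); rewrite lee_fin => kr.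
by rewrite -lez_nat; apply: le_trans kr _; exact: lez_abs.
Qed.

End PrimeChains.

Theorem theorem3p11 (d : Order.disp_t) (L : multLatticeType d) (m : L) :
  C_lattice_domain L -> principally_generated L -> quasi_local m ->
  (TAFL L <-> (dimension L <= 1)%E /\ PTAFL L) /\
  (TAFL L ->
     Meet (range (fun n : nat => (m ^+ n)%g)) = (\bot)%O /\
     comparable_elt (m ^+ 2)%g).
Proof.
move=> domL prinL locL; have [CL prime0] := domL.
have mP := max_prime locL.
have prime_max_dim : (dimension L <= 1)%E -> forall p : L, prime_elt p -> p <> \bot -> p = m.
  move=> /dimension_le1P dim1 p pP p0; apply: contrapT => pm.
  suff /dim1 : prime_chain L 2 by [].
  exists [:: \bot; p; m]; split=> //=.
    rewrite lt0x andbT lt_neqAle (proper_le locL) ?andbT; last by case: pP.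
    by apply/andP; split; apply/eqP.
  by move=> q; rewrite !inE => /or3P[]/eqP->.
have dim_TAFL : TAFL L -> (dimension L <= 1)%E.
  move=> [_ TAL]; apply/dimension_le1P => n [s [sn sorts sP]].
  rewrite leqNgt; apply/negP => n1.
  (* Only the first three primes matter: [p1 < p2] forces [p1 = \bot], which contradicts
     [p0 < p1]. *)
  case: s sn sorts sP => [//|p0 [|p1 [|p2 s]]]; try by move=> [nE]; rewrite -nE in n1.
  move=> _ /= /and3P[p01 p12 _] sP.
  have p1P : prime_elt p1 by apply: sP; rewrite !inE eqxx orbT.
  have p2P : prime_elt p2 by apply: sP; rewrite !inE eqxx !orbT.
  have p1E : p1 = \bot.
    apply: (prime_bot domL prinL locL TAL p1P p2P (ltW p12)).
    by move=> p21; move: (lt_le_trans p12 p21); rewrite ltxx.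
  by move: p01; rewrite p1E ltx0.
have TAFL_PTAFL : TAFL L -> (dimension L <= 1)%E /\ PTAFL L.
  by move=> LT; split; [exact: dim_TAFL|split=> // x _; case: LT].
split.
  split=> // -[/prime_max_dim pmax [_ PTAL]]; split=> //.
  exact: (TA_product_all domL prinL locL pmax PTAL).
move=> /TAFL_PTAFL[/prime_max_dim pmax [_ PTAL]]; split.
  exact: (Meet_exp_max domL prinL locL pmax PTAL).
exact: (comparable_sqr_max domL prinL locL pmax PTAL).
Qed.
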